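(* Let $f(x)=a_1x+a_2x^2+\cdots+a_kx^k+\cdots$ be a formal power series with coefficients in a field and $a_1\neq 0$, and write its $n$-fold composition as $f^{(n)}(x)=f_1^{(n)}x+\cdots+f_k^{(n)}x^k+\cdots$. Then $f_k^{(n)}$ can be written as $$f_k^{(n)}=a_k\,C_{k,n}+P_k^{(n)},\qquad C_{k,n}=a_1^{n-1}\sum_{i=0}^{n-1}a_1^{i(k-1)},\qquad P_k^{(n)}=\sum_{i=0}^{n-2}a_1^{ki}\left[\sum_{j=2}^{k-1}f_j^{(n-i-1)}\,a_k^{[j]}\right],$$ that is, $$f_k^{(n)}=a_k\,a_1^{n-1}\sum_{i=0}^{n-1}a_1^{i(k-1)}+\sum_{i=0}^{n-2}a_1^{ki}\left[\sum_{j=2}^{k-1}f_j^{(n-i-1)}\,a_k^{[j]}\right].$$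
   Context: Here $n$ and $k$ are positive integers. The $n$-fold composition is defined by $f^{(1)}(x)=f(x)$ and $f^{(n)}(x)=f^{(n-1)}(f(x))$ for $n\ge 2$; $f_k^{(n)}$ is the coefficient of $x^k$ in $f^{(n)}(x)$. For positive integers $j,k$, $a_k^{[j]}$ denotes the coefficient of $x^k$ in the $j$-th multiplicative power $(f(x))^j$. Empty sums are $0$.
   Formalization: The formula is stated for k ≥ 2 rather than all positive k: for k = 1 its right-hand side is n·a_1^n while f_1^(n) = a_1^n, so it fails, e.g. for f(x) = x over the rationals with n = 2. *)

(* Defs.v *)
From mathcomp Require Import all_boot all_algebra.

Set Implicit Arguments.
Unset Strict Implicit.
Unset Printing Implicit Defensive.

Import GRing.Theory.
Local Open Scope ring_scope.

(* A formal power series is its sequence of coefficients: [g k] is the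
   coefficient of x^k in g. *)
Definition fps (F : fieldType) := nat -> F.

Section FormalPowerSeries.
Variable F : fieldType.
Implicit Types f g : fps F.

Definition fps_one : fps F := fun k => (k == 0%N)%:R.

Definition fps_X : fps F := fun k => (k == 1%N)%:R.

Definition fps_mul f g : fps F := fun k => \sum_(i < k.+1) f i * g (k - i)%N.

Definition fps_exp f (j : nat) : fps F := iter j (fps_mul f) fps_one.

(* g(f(x)) for f without constant term. The coefficient of x^k in
   \sum_j g_j f^j only involves j <= k because f^j has order at least j
   (fps_exp_low); fps_comp_trunc shows that the cut-off is immaterial. *)
Definition fps_comp g f : fps F :=
  fun k => \sum_(j < k.+1) g j * fps_exp f j k.

(* The n-fold composition. The value x at n = 0 is only a convention. *)
Fixpoint fps_iter f (n : nat) : fps F :=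
  match n with
  | 0 => fps_X
  | m.+1 => if m is 0 then f else fps_comp (fps_iter f m) f
  end.

Lemma fps_exp_low f j k : f 0%N = 0 -> (k < j)%N -> fps_exp f j k = 0.
Proof.
move=> f0; elim: j k => [//|j IHj] k ltkj.
rewrite /fps_exp iterS -/(fps_exp f j) /fps_mul big1 // => -[[|i] /= ltik] _.
  by rewrite f0 mul0r.
rewrite IHj ?mulr0 // ltn_subLR //.
by rewrite addSn ltnS (leq_trans _ (leq_addl _ _)).
Qed.

Lemma fps_comp_trunc g f k N : f 0%N = 0 -> (k <= N)%N ->
  fps_comp g f k = \sum_(j < N.+1) g j * fps_exp f j k.
Proof.
move=> f0 lekN; rewrite /fps_comp (big_ord_widen N.+1 (fun j => g j * fps_exp f j k)) //.
rewrite big_mkcond; apply: eq_bigr => j _; case: ltnP => // ltkj.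
by rewrite fps_exp_low ?mulr0.
Qed.

End FormalPowerSeries.

(* Main.v *)
Require Import Defs.
From mathcomp Require Import all_boot all_algebra.
From mathcomp Require Import ring.
Import GRing.Theory.
Local Open Scope ring_scope.

(** Compare coefficients of x^k in f^(n+1)(x) = f^(n)(f(x)), that is, in the
    sum over j of f_j^(n) (f(x))^j.  As f has no constant term, (f(x))^j starts
    with a_1^j x^j, so only 1 <= j <= k contribute.  The two extreme terms are
    explicit, namely f_1^(n) a_k = a_1^n a_k for j = 1 and f_k^(n) a_1^k for
    j = k, which gives for k >= 2 the first-order linear recurrence in n
    [fps_iterS_coef]:

      f_k^(n+1) = a_1^k f_k^(n) + a_1^n a_k
                  + sum_(2 <= j < k) f_j^(n) a_k^[j].

    The formula is this recurrence unrolled down to f_k^(1) = a_k, by induction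
    on n.  Multiplying by a_1^k moves every term of both sums over i to index
    i + 1, and the inhomogeneous part supplies the terms of index 0. *)

Section Coefficients.
Variables (F : fieldType) (f : fps F).

Lemma fps_exp1 k : fps_exp f 1 k = f k.
Proof.
rewrite /fps_exp /= /fps_mul big_ord_recr /= big1 => [|i _].
  by rewrite add0r subnn /fps_one eqxx mulr1.
by rewrite /fps_one subn_eq0 leqNgt ltn_ord mulr0.
Qed.

Hypothesis f0 : f 0%N = 0.

(** In the convolution defining f * f^j at degree j + 1, the factor f kills
    the index 0 and the low order of f^j kills every index above 1. *)
Lemma fps_exp_diag j : fps_exp f j j = f 1%N ^+ j.
Proof.
elim: j => [|j IHj]; first by rewrite /fps_exp /= /fps_one eqxx expr0.
rewrite /fps_exp iterS -/(fps_exp f j) /fps_mul !big_ord_recl /=.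
rewrite f0 mul0r add0r subSS subn0 IHj big1 ?addr0 ?exprS // => i _.
rewrite (@fps_exp_low _ f) ?mulr0 //= /bump /= !add1n subSS.
by have ltij := ltn_ord i; rewrite ltn_subrL (leq_ltn_trans _ ltij).
Qed.

Lemma fps_comp_coef1 g : fps_comp g f 1 = g 1%N * f 1%N.
Proof.
rewrite /fps_comp -(big_mkord xpredT (fun j => g j * fps_exp f j 1)).
rewrite big_ltn // big_nat1 fps_exp1.
by rewrite /fps_exp /= /fps_one mulr0 add0r.
Qed.

Lemma fps_comp_coef g k : (2 <= k)%N ->
  fps_comp g f k = g 1%N * f k + \sum_(2 <= j < k) g j * fps_exp f j k
                   + g k * f 1%N ^+ k.
Proof.
move=> k2; have k1 := ltnW k2.
rewrite /fps_comp -(big_mkord xpredT (fun j => g j * fps_exp f j k)).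
rewrite big_nat_recr //= fps_exp_diag big_ltn // big_ltn // fps_exp1.
by rewrite /fps_exp /= /fps_one eqn0Ngt k1 mulr0 add0r.
Qed.

Lemma fps_iter_coef1 n : fps_iter f n 1 = f 1%N ^+ n.
Proof.
elim: n => [|[|n] IHn]; first by rewrite /= /fps_X eqxx.
  by rewrite expr1.
by rewrite exprSr -IHn -fps_comp_coef1.
Qed.

Lemma fps_iterS_coef n k : (2 <= k)%N ->
  fps_iter f n.+2 k =
    f 1%N ^+ n.+1 * f k + \sum_(2 <= j < k) fps_iter f n.+1 j * fps_exp f j k
    + fps_iter f n.+1 k * f 1%N ^+ k.
Proof. by move=> k2; rewrite -fps_iter_coef1 -fps_comp_coef. Qed.

End Coefficients.

Theorem lemma3p1p1 (F : fieldType) (f : fps F) (hf0 : f 0%N = 0)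
  (hf1 : f 1%N != 0) (n k : nat) (hn : (1 <= n)%N) (hk : (2 <= k)%N) :
  fps_iter f n k =
    f k * (f 1%N ^+ (n - 1) * \sum_(0 <= i < n) f 1%N ^+ (i * (k - 1)))
    + \sum_(0 <= i < n - 1)
        f 1%N ^+ (k * i)
        * (\sum_(2 <= j < k) fps_iter f (n - i - 1) j * fps_exp f j k).
Proof.
case: n hn => // n _; rewrite subn1 succnK.
elim: n => [|n IHn].
  by rewrite big_nat1 big_geq // mul0n !expr0 !mulr1 addr0.
rewrite fps_iterS_coef // IHn.
rewrite [in RHS]big_nat_recl // [in X in _ = _ + X]big_nat_recl //.
(* Both shifted sums on the right carry the factor a_1^k of the recurrence:
   the first one as a_1^(k-1), completed by a_1^(n+1) = a_1 a_1^n. *)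
have shiftC : \sum_(0 <= i < n.+1) f 1%N ^+ (i.+1 * (k - 1)) =
    f 1%N ^+ (k - 1) * \sum_(0 <= i < n.+1) f 1%N ^+ (i * (k - 1)).
  by rewrite mulr_sumr; apply: eq_bigr => i _; rewrite mulSn exprD.
have shiftP : \sum_(0 <= i < n) f 1%N ^+ (k * i.+1) *
      (\sum_(2 <= j < k) fps_iter f (n.+2 - i.+1 - 1) j * fps_exp f j k) =
    f 1%N ^+ k * \sum_(0 <= i < n) f 1%N ^+ (k * i) *
      (\sum_(2 <= j < k) fps_iter f (n.+1 - i - 1) j * fps_exp f j k).
  by rewrite mulr_sumr; apply: eq_bigr => i _; rewrite mulnS exprD -mulrA subSS.
have powk : f 1%N ^+ k = f 1%N * f 1%N ^+ (k - 1).
  by rewrite -exprS subn1 prednK // ltnW.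
rewrite shiftC shiftP mul0n muln0 !expr0 subn0 (subn1 n.+2) succnK powk exprS.
by ring.
Qed.
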